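(* Let $q$ be a prime power and let $m$ be a positive integer that is relatively prime to $q$ and is not a prime power. Let $k$ be an integer with $1<k<\sigma_0(m)$, where $\sigma_0(m)$ denotes the number of positive divisors of $m$. Let $\mathbf d=(d_1,\ldots,d_k)\in\lambda_k(m)$ and let $\mathbf a=(a_1,\ldots,a_k)\in\mathbb F_{\mathbf d}$ be a normal $\mathbf d$-admissible $k$-tuple. Set $g:=\operatorname{lcm}(x^{d_1}-1,\ldots,x^{d_k}-1)\in\mathbb F_q[x]$. Then there exist exactly $\Phi(x^m-1)/\Phi(g)$ elements $\alpha\in\mathbb F_{q^m}$ that are normal over $\mathbb F_q$ and satisfy $\operatorname{Tr}_{m/d_i}(\alpha)=a_i$ for every $1\le i\le k$.
   Context: For a prime power $q$, $\mathbb F_q$ is the finite field with $q$ elements, and all fields $\mathbb F_{q^d}$ with $d\mid m$ are regarded as subfields of $\mathbb F_{q^m}$. For $d\mid n$ and $\alpha\in\mathbb F_{q^n}$, $\operatorname{Tr}_{n/d}(\alpha)=\sum_{i=0}^{n/d-1}\alpha^{q^{id}}\in\mathbb F_{q^d}$. An element $\alpha\in\mathbb F_{q^n}$ is normal over $\mathbb F_q$ (as an element of $\mathbb F_{q^n}$) if $\{\alpha,\alpha^q,\ldots,\alpha^{q^{n-1}}\}$ is a basis of $\mathbb F_{q^n}$ over $\mathbb F_q$. $\lambda_k(m)$ is the set of $k$-tuples $\mathbf d=(d_1,\ldots,d_k)$ where $d_1<\cdots<d_k<m$ are positive divisors of $m$ such that $d_i\nmid d_j$ for all $1\le i<j\le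 k$. For such $\mathbf d$, $\mathbb F_{\mathbf d}=\prod_{i=1}^k\mathbb F_{q^{d_i}}$. A $k$-tuple $\mathbf a=(a_1,\ldots,a_k)\in\mathbb F_{\mathbf d}$ is $\mathbf d$-admissible if for all $1\le i<j\le k$, $\operatorname{Tr}_{d_i/\gcd(d_i,d_j)}(a_i)=\operatorname{Tr}_{d_j/\gcd(d_i,d_j)}(a_j)$. A $\mathbf d$-admissible $\mathbf a$ is normal if, for every $i$, $a_i$ is normal over $\mathbb F_q$ as an element of $\mathbb F_{q^{d_i}}$. For nonzero $f\in\mathbb F_q[x]$, $\Phi(f)=\left|\left(\mathbb F_q[x]/\langle f\rangle\right)^*\right|$ is the number of units of the ring $\mathbb F_q[x]/\langle f\rangle$. *)

(* Defs.v *)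
From HB Require Import structures.
From mathcomp Require Import all_boot all_algebra all_field.

Set Implicit Arguments.
Unset Strict Implicit.
Unset Printing Implicit Defensive.

Import GRing.Theory.
Local Open Scope ring_scope.

(* F plays the role of F_q, with q = #|F|, and L that of the ambient field    *)
(* F_{q^m}, with m = \dim {:L}; F_{q^d} is the subfield of L fixed by the     *)
(* d-th power of the Frobenius automorphism x |-> x ^ q.                      *)

Section FiniteFields.

Variables (F : finFieldType) (L : fieldExtType F).
Implicit Types (x : L) (d n : nat).

Definition frob d x : L := x ^+ (#|F| ^ d).

Fact pnat_card_pchar (R : comNzRingType) :
  [pchar R] =i [pchar F] -> forall d, [pchar R].-nat (#|F| ^ d)%N.
Proof.
have [p _ pcharF] := finPcharP F => eqRF d.
rewrite (eq_pnat _ eqRF) (eq_pnat _ (pcharf_eq pcharF)).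
have -> : #|F| = (p ^ logn p #|F|)%N := card_pprimeChar pcharF.
by rewrite !pnatX pnat_id ?(pcharf_prime pcharF).
Qed.

Fact frob_is_zmod_morphism d : zmod_morphism (frob d).
Proof.
move=> x y; rewrite /frob exprDn_pchar; last first.
  by apply: pnat_card_pchar => p; rewrite pchar_lalg.
congr (_ + _); rewrite -[RHS]addr0; apply/eqP.
rewrite addr0 -addr_eq0 -exprDn_pchar ?addNr; last first.
  by apply: pnat_card_pchar => p; rewrite pchar_lalg.
by rewrite expr0n gtn_eqF // expn_gt0 [#|F|](cardD1 0).
Qed.

Fact frob_is_monoid_morphism d : monoid_morphism (frob d).
Proof. by split=> [|x y]; rewrite /frob ?expr1n ?exprMn. Qed.

Fact frob_is_scalable d : scalable (frob d).
Proof.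
move=> a x; rewrite /frob exprZn; congr (_ *: _).
elim: d => [|d IHd]; first exact: expr1.
by rewrite expnS exprM expf_card.
Qed.

HB.instance Definition _ d :=
  GRing.isZmodMorphism.Build L L (frob d) (frob_is_zmod_morphism d).
HB.instance Definition _ d :=
  GRing.isMonoidMorphism.Build L L (frob d) (frob_is_monoid_morphism d).
HB.instance Definition _ d :=
  GRing.isScalable.Build F L L *:%R (frob d) (@frob_is_scalable d).

Definition Fqn d : {subfield L} := [aspace of fixedSpace (linfun (frob d))].

Lemma mem_Fqn d x : (x \in Fqn d) = (x ^+ (#|F| ^ d) == x).
Proof. by rewrite (sameP fixedSpaceP eqP) lfunE. Qed.

Lemma dim_Fqn d : (0 < d)%N -> (d %| \dim {:L})%N -> \dim (Fqn d) = d.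
Proof.
move=> d0 /dvdnP[e dimL]; have q1 : (1 < #|F|)%N := finNzRing_gt1 F.
pose K := FinFieldExtType L; set Q := (#|F| ^ d)%N.
have Q1 : (1 < Q)%N by rewrite (ltn_exp2l 0).
have cardK : #|K| = (Q ^ e)%N.
  rewrite -expnM mulnC -dimL -(card_vspace (fullv : {vspace finvect_type L})).
  by apply: eq_card => x; rewrite memvf.
have dvX : ('X^Q - 'X : {poly K}) %| 'X^(Q ^ e) - 'X.
  elim: (e) => [|j IHj]; first by rewrite expn0 expr1 subrr dvdp0.
  have -> : 'X^(Q ^ j.+1) - 'X
      = ('X^(Q ^ j) ^+ Q - 'X ^+ Q) + ('X^Q - 'X) :> {poly K}.
    by rewrite expnSr exprM addrA subrK.
  by rewrite dvdp_add // subrXX (dvdp_trans IHj) // dvdp_mulIl.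
rewrite -cardK finField_genPoly -big_enum in dvX.
have [msk eq_p] := dvdp_prod_XsubC dvX; set r := mask msk _ in eq_p.
have r_uniq : uniq r by rewrite mask_uniq ?enum_uniq.
have size_r : size r = Q.
  apply: succn_inj; rewrite -(size_prod_XsubC _ id) -(eqp_size eq_p).
  by rewrite size_polyDl size_polyXn // size_polyN size_polyX ltnS.
have : #|(Fqn d : {vspace finvect_type L})| = Q.
  rewrite -size_r -(card_uniqP r_uniq); apply: eq_card => x.
  rewrite mem_Fqn -root_prod_XsubC -(eqp_root eq_p).
  by rewrite /root !hornerE subr_eq0.
by rewrite card_vspace => /eqP; rewrite eqn_exp2l // => /eqP.
Qed.

(* Tr n d is the trace map F_{q^n} -> F_{q^d}, for d %| n. *)
Definition Tr n d x : L := \sum_(i < n %/ d) x ^+ (#|F| ^ (i * d)).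

Definition normal_elt n x : bool :=
  basis_of (Fqn n) [seq x ^+ (#|F| ^ i) | i <- iota 0 n].

Definition in_Fd k (d : k.-tuple nat) (a : k.-tuple L) : Prop :=
  forall i : 'I_k, tnth a i \in Fqn (tnth d i).

Definition admissible k (d : k.-tuple nat) (a : k.-tuple L) : Prop :=
  in_Fd d a /\
  forall i j : 'I_k, (i < j)%N ->
    let g := gcdn (tnth d i) (tnth d j) in
    Tr (tnth d i) g (tnth a i) = Tr (tnth d j) g (tnth a j).

Definition normal_admissible k (d : k.-tuple nat) (a : k.-tuple L) : Prop :=
  admissible d a /\ forall i : 'I_k, normal_elt (tnth d i) (tnth a i).

End FiniteFields.

Definition lambda k m (d : k.-tuple nat) : Prop :=
  [/\ forall i : 'I_k, tnth d i \in divisors m,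
      forall i : 'I_k, (tnth d i < m)%N,
      forall i j : 'I_k, (i < j)%N -> (tnth d i < tnth d j)%N
    & forall i j : 'I_k, (i < j)%N -> ~~ (tnth d i %| tnth d j)%N].

Section Polynomials.

Variable F : finFieldType.
Implicit Types f g h : {poly F}.

(* {poly %/ h} is the quotient ring F[x]/<h> only when h is monic of positive *)
(* degree, hence the normalisation of f; for a nonzero constant f, F[x]/<f>   *)
(* is the zero ring, whose only element is a unit.  Meaningless for f = 0.    *)
Definition Phi f : nat :=
  if (size f <= 1)%N then 1%N
  else #|[set u : {poly %/ (lead_coef f)^-1 *: f} | u \is a GRing.unit]|.

Definition lcmp f g : {poly F} := (f * g) %/ gcdp f g.

Lemma dvdp_lcm f g h :
  f != 0 -> g != 0 -> (lcmp f g %| h) = (f %| h) && (g %| h).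
Proof.
move=> f0 g0; have d0: gcdp f g != 0 by rewrite gcdp_eq0 negb_and f0.
have dv: gcdp f g %| f * g by rewrite dvdp_mulr ?dvdp_gcdl.
rewrite /lcmp; apply/idP/andP => [lcm_h|[fh gh]].
  split; apply: dvdp_trans lcm_h; rewrite -(dvdp_mul2r _ _ d0) divpK //.
    by rewrite dvdp_mul2l // dvdp_gcdr.
  by rewrite mulrC dvdp_mul2r // dvdp_gcdl.
rewrite -(dvdp_mul2r _ _ d0) divpK //.
rewrite (eqp_dvdr _ (mulp_gcdr _ _ _)) dvdp_gcd.
by rewrite {1}mulrC !dvdp_mul.
Qed.

Lemma lcmp_neq0 f g : f != 0 -> g != 0 -> lcmp f g != 0.
Proof.
move=> f0 g0; have := mulf_neq0 f0 g0; apply: contraNneq => l0.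
have: lcmp f g %| f * g by rewrite dvdp_lcm // dvdp_mulr ?dvdp_mull.
by rewrite l0 dvd0p.
Qed.

Lemma dvdp_biglcm k (f : 'I_k -> {poly F}) h :
  (forall i, f i != 0) ->
  reflect (forall i, f i %| h) (\big[lcmp/1]_(i < k) f i %| h).
Proof.
move=> f0; suff [_ ->]: \big[lcmp/1]_(i < k) f i != 0 /\
    (\big[lcmp/1]_(i < k) f i %| h) = [forall i, f i %| h].
  exact: forallP.
have -> : [forall i, f i %| h] = \big[andb/true]_(i < k) (f i %| h).
  by rewrite big_andE.
elim/big_rec2: _ => [|i b p _ [p0 IH]]; first by rewrite oner_neq0 dvd1p.
by rewrite lcmp_neq0 // dvdp_lcm // IH.
Qed.

End Polynomials.

(* Main.v *)
From HB Require Import structures.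
Require Import Defs.
From mathcomp Require Import all_boot all_algebra all_field.
From mathcomp Require Import ring.

(** Write M for X^m - 1.  Let F[x] act on L with x acting as the Frobenius
    automorphism; since M annihilates L, this makes L a module over F[x]/<M>.
    A normal element is exactly a generator of this module with annihilator
    <M>, and one exists ([exists_qorder]): M is squarefree because m is
    coprime to #|F|, so it is enough to find, for each irreducible factor P of
    M, an element with annihilator <P>, and to add these up.  For one factor,
    (M/P) acts as a nonzero polynomial map of degree less than #|L|, hence does
    not vanish on L, and any nonzero value of it has annihilator <P>.

    Fix such a generator b.  Every element is f b for an f that is unique
    modulo M, it is normal if and only if f is a unit modulo M
    ([qorder_act]), and the trace to F_{q^n} is multiplication by
    M / (X^n - 1), so that c_n := Tr_{m/n}(b) generates F_{q^n} with
    annihilator <X^n - 1> ([generator_trace]).  Writing a_i = h_i c_{d_i}: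
    - a_i is normal if and only if h_i is a unit modulo X^{d_i} - 1;
    - Tr_{m/d_i}(f b) = a_i if and only if f = h_i modulo X^{d_i} - 1;
    - admissibility says that h_i = h_j modulo X^{gcd(d_i, d_j)} - 1, a multiple
      of the gcd of the two moduli ([gcdp_Xn_sub1]).
    The Chinese remainder theorem for pairwise compatible congruences
    ([crt_compatible]) merges the conditions into one, f = h modulo g, with h a
    unit modulo g.  The elements to count are therefore the units of F[x]/<M>
    lying over one given unit of F[x]/<g>.  Reduction is surjective on units
    ([coprimep_lift]), so all its fibres have Phi(M) / Phi(g) elements
    ([card_unit_fiber_Phi]). *)

Set Implicit Arguments.
Unset Strict Implicit.
Unset Printing Implicit Defensive.

Import GRing.Theory.
Local Open Scope ring_scope.

(** * Congruences between polynomials *)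

Section Arithmetic.

Context {F : finFieldType}.
Implicit Types A B C P Q f g h y : {poly F}.

Lemma dvdp_gcd_comb A C y :
  gcdp A C %| y -> exists u v, y = u * A + v * C.
Proof.
case: (Bezoutp A C) => -[u v] /= uvE; rewrite -(eqp_dvdl _ uvE).
by case/dvdpP => w ->; exists (w * u), (w * v); rewrite -!mulrA -mulrDr.
Qed.

(** The half of the distributivity of gcd over lcm that the Chinese remainder
    theorem needs.  With A = a D, B = b D, D = gcd(A, B) and u a + v b = 1,
    split y as u a y + v b y, then expand the first y on B and C and the second
    on A and C: the terms a B and b A that come out are both the lcm. *)
Lemma dvdp_gcd_lcm A B C y : A != 0 ->
  gcdp A C %| y -> gcdp B C %| y -> gcdp (lcmp A B) C %| y.
Proof.
move=> A0 /dvdp_gcd_comb[s [t yA]] /dvdp_gcd_comb[s' [t' yB]].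
have /coprimep_div_gcd/Bezout_eq1_coprimepP[[u v] /=]: (A != 0) || (B != 0).
  by rewrite A0.
have /divpK := dvdp_gcdl A B; have /divpK := dvdp_gcdr A B.
have g0: gcdp A B != 0 by rewrite gcdp_eq0 negb_and A0.
rewrite /lcmp; move: (A %/ gcdp A B) (B %/ gcdp A B) => a b bB aA uv1.
have lB : A * B %/ gcdp A B = a * B by rewrite -{1}aA mulrAC mulpK.
have lA : A * B %/ gcdp A B = b * A by rewrite -{1}bB mulrA mulpK // mulrC.
have -> : y = u * s' * (a * B) + v * s * (b * A) + (u * a * t' + v * b * t) * C.
  have -> : y = u * a * y + v * b * y by rewrite -mulrDl uv1 mul1r.
  by rewrite {1}yB yA; ring.
apply: dvdp_add; [apply: dvdp_add|]; apply: dvdp_mull.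
- by rewrite -lB dvdp_gcdl.
- by rewrite -lA dvdp_gcdl.
exact: dvdp_gcdr.
Qed.

Lemma coprimep_lcmr f A B :
  coprimep f A -> coprimep f B -> coprimep f (lcmp A B).
Proof.
move=> fA fB; have: coprimep f (A * B) by rewrite coprimepMr fA.
by apply: coprimep_dvdl; rewrite /lcmp divp_dvd // dvdp_mulr // dvdp_gcdl.
Qed.

Lemma crt2 A C f g :
  gcdp A C %| f - g -> exists2 h, A %| h - f & C %| h - g.
Proof.
case/dvdp_gcd_comb=> u [v fgE]; exists (f - u * A).
  by rewrite addrAC subrr add0r dvdpNr dvdp_mull.
by rewrite addrAC fgE addrAC subrr add0r dvdp_mull.
Qed.

(** Induction on the list of moduli: a solution h for the first ones meets the
    next congruence after a correction by a multiple of their lcm, which is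
    possible once gcd(lcm, P i) divides the discrepancy h - h_ i;
    [dvdp_gcd_lcm] reduces that to the pairwise compatibility. *)
Lemma crt_compatible (I : eqType) (s : seq I) (P h_ : I -> {poly F}) :
    (forall i, P i != 0) ->
    (forall i j, gcdp (P i) (P j) %| h_ i - h_ j) ->
  exists h, forall i, i \in s -> P i %| h - h_ i.
Proof.
move=> P0 hP; elim: s => [|i s [h hs]]; first by exists 0.
have G0 (r : seq I) : \big[@lcmp F/1]_(j <- r) P j != 0.
  elim/big_rec: _ => [|j G _ G0]; first exact: oner_neq0.
  exact: lcmp_neq0.
have dvG (r : seq I) j : j \in r -> P j %| \big[@lcmp F/1]_(k <- r) P k.
  elim: r => //= k r IHr; rewrite big_cons in_cons.
  have := dvdpp (lcmp (P k) (\big[@lcmp F/1]_(k <- r) P k)).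
  rewrite dvdp_lcm // => /andP[dk dr] /orP[/eqP-> //|/IHr jr].
  exact: dvdp_trans jr dr.
have: gcdp (\big[@lcmp F/1]_(j <- s) P j) (P i) %| h - h_ i.
  have {hs}: {in s, forall j, gcdp (P j) (P i) %| h - h_ i}.
    move=> j js; rewrite -[h](subrK (h_ j)) -addrA dvdp_add //.
    by rewrite (dvdp_trans (dvdp_gcdl _ _)) ?hs.
  elim: (s) => [_|j r IHr hr].
    by rewrite big_nil (eqp_dvdl _ (gcd1p _)) dvd1p.
  rewrite big_cons dvdp_gcd_lcm ?hr ?mem_head // IHr // => k kr.
  by rewrite hr // in_cons kr orbT.
case/crt2=> h' hG hi; exists h' => j; rewrite in_cons => /predU1P[-> //|js].
rewrite -[h'](subrK h) -addrA dvdp_add ?hs //.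
exact: dvdp_trans (dvG _ _ js) hG.
Qed.

Lemma coprimep_congr Q f g : Q %| f - g -> coprimep g Q -> coprimep f Q.
Proof.
case/dvdpP=> w fgE; rewrite -[f](subrK g) fgE => gQ.
by rewrite coprimep_sym coprimep_addl_mul coprimep_sym.
Qed.

(** Units lift along F[x]/<P> -> F[x]/<Q>.  The lift u is required to be h
    modulo Q and 1 modulo r, where r is the largest divisor of P coprime to Q.
    A common divisor of u and P is then coprime to Q, so it divides r, and it is
    coprime to r as well. *)
Lemma coprimep_lift P Q h : P != 0 -> coprimep h Q ->
  exists2 u, Q %| u - h & coprimep u P.
Proof.
move=> P0 hQ; case: (gdcopP Q P) => r rP; rewrite (negPf P0) orbF => rQ rmax.
have: gcdp Q r %| h - 1.
  by rewrite (eqp_dvdl (d2 := 1)) ?dvd1p // gcdp_eqp1 coprimep_sym.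
case/crt2=> u uQ ur; exists u => //.
have {}uQ := coprimep_congr uQ hQ; have {}ur := coprimep_congr ur (coprime1p r).
apply/coprimepP=> c cu cP.
have cr : c %| r by apply: rmax => //; exact: coprimep_dvdr cu uQ.
by have /coprimepP := ur; apply.
Qed.

(** * Fibres of the reduction map on unit groups *)

Lemma mk_monic_id P : P \is monic -> (1 < size P)%N -> mk_monic P = P.
Proof. by move=> Pm P1; rewrite /mk_monic P1 Pm. Qed.

Lemma unit_qpolyE P (u : {poly %/ P}) : P \is monic -> (1 < size P)%N ->
  (u \is a GRing.unit) = coprimep (val u) P.
Proof.
move=> Pm P1; rewrite -[LHS]/(coprimep (mk_monic P) (val u)) coprimep_sym.
by congr coprimep; exact: mk_monic_id.
Qed.

Lemma val_in_qpoly P f : P \is monic -> (1 < size P)%N ->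
  val (in_qpoly P f) = f %% P.
Proof.
by move=> Pm P1; rewrite /= mk_monic_id // -Pdiv.IdomainMonic.modpE.
Qed.

Lemma dvdp_in_qpoly P Q f h : P \is monic -> (1 < size P)%N -> Q %| P ->
  (Q %| val (in_qpoly P f) - h) = (Q %| f - h).
Proof.
move=> Pm P1 QP; rewrite val_in_qpoly // [in RHS](divp_eq f P) -addrA.
by rewrite (dvdp_addr _ (dvdp_mull _ QP)).
Qed.

Lemma coprimep_in_qpoly P f : P \is monic -> (1 < size P)%N ->
  (in_qpoly P f \is a GRing.unit) = coprimep f P.
Proof.
by move=> Pm P1; rewrite unit_qpolyE // val_in_qpoly // coprimep_modl.
Qed.

Lemma in_qpoly_val P (u : {poly %/ P}) : in_qpoly P (val u) = u.
Proof. by apply: val_inj; apply: in_qpoly_small; rewrite size_mk_monic. Qed.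

Lemma eq_in_qpoly P f g : P \is monic -> (1 < size P)%N ->
  (in_qpoly P f == in_qpoly P g) = (P %| f - g).
Proof.
move=> Pm P1; rewrite -val_eqE !val_in_qpoly //.
by rewrite /dvdp modpD modpN subr_eq0.
Qed.

Definition unit_fiber P Q h : {set {poly %/ P}} :=
  [set u : {poly %/ P} | u \is a GRing.unit & Q %| val u - h].

(** Multiplication by a unit of F[x]/<P> that lifts h' / h maps the fibre over
    h injectively into the fibre over h'. *)
Lemma leq_unit_fiber P Q h h' : P \is monic -> (1 < size P)%N -> Q %| P ->
    coprimep h Q -> coprimep h' Q ->
  (#|unit_fiber P Q h| <= #|unit_fiber P Q h'|)%N.
Proof.
move=> Pm P1 QP hQ h'Q; have /Bezout_eq1_coprimepP[[c e] /= ce1] := hQ.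
have cQ : coprimep c Q.
  by apply/Bezout_eq1_coprimepP; exists (h, e); rewrite /= mulrC.
(* By Bezout, c is an inverse of h modulo Q. *)
have := @coprimep_lift P Q (c * h') (monic_neq0 Pm).
rewrite coprimepMl cQ h'Q => /(_ isT)[w wQ wP].
have wU : in_qpoly P w \is a GRing.unit by rewrite coprimep_in_qpoly.
rewrite -(card_imset _ (mulIr wU)).
apply/subset_leq_card/subsetP=> _ /imsetP[u + ->].
rewrite inE => /andP[uU uh].
rewrite inE unitrMl // uU -[u]in_qpoly_val -in_qpolyM dvdp_in_qpoly //.
have -> : val u * w - h' = (val u - h) * w + h * (w - c * h') - e * Q * h'.
  have -> : e * Q = 1 - c * h by rewrite -ce1; ring.
  ring.
rewrite dvdp_sub ?dvdp_add //; first exact: dvdp_mulr.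
  exact: dvdp_mull.
by rewrite dvdp_mulr // dvdp_mull.
Qed.

Lemma card_unit_fiber P Q h : P \is monic -> Q \is monic -> (1 < size Q)%N ->
    Q %| P -> coprimep h Q ->
  (#|unit_fiber P Q h| * #|[set v : {poly %/ Q} | v \is a GRing.unit]| =
     #|[set u : {poly %/ P} | u \is a GRing.unit]|)%N.
Proof.
move=> Pm Qm Q1 QP hQ.
have P1 : (1 < size P)%N := leq_trans Q1 (dvdp_leq (monic_neq0 Pm) QP).
rewrite -[RHS]sum1_card.
rewrite (partition_big (fun u : {poly %/ P} => in_qpoly Q (val u))
  (fun v => v \in [set v : {poly %/ Q} | v \is a GRing.unit])) /=; last first.
  move=> u; rewrite !inE unit_qpolyE // coprimep_in_qpoly //.
  exact: coprimep_dvdl.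
rewrite mulnC -sum_nat_const; apply: eq_bigr => v.
rewrite inE unit_qpolyE // => vQ.
have -> : #|unit_fiber P Q h| = #|unit_fiber P Q (val v)|.
  by apply/eqP; rewrite eqn_leq !leq_unit_fiber.
rewrite -sum1_card; apply: eq_bigl => u.
by rewrite !inE -[v in RHS]in_qpoly_val eq_in_qpoly.
Qed.

Lemma Phi_gt0 f : (0 < Phi f)%N.
Proof.
rewrite /Phi; case: ifP => // _.
by apply/card_gt0P; exists 1; rewrite inE unitr1.
Qed.

(** [Phi g] counts units modulo the monic associate of g; divisibility by g and
    by its associate are the same condition, so the fibre does not change. *)
Lemma card_unit_fiber_Phi P g h : P \is monic -> (1 < size g)%N ->
    g %| P -> coprimep h g -> (#|unit_fiber P g h| * Phi g = Phi P)%N.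
Proof.
move=> Pm g1 gP hg; have g0: g != 0 by rewrite -size_poly_gt0 ltnW.
have P1 : (1 < size P)%N := leq_trans g1 (dvdp_leq (monic_neq0 Pm) gP).
rewrite /Phi !ifN -?ltnNge // (monicP Pm) invr1 scale1r.
have l0 : (lead_coef g)^-1 != 0 by rewrite invr_eq0 lead_coef_eq0.
rewrite -(@card_unit_fiber P ((lead_coef g)^-1 *: g) h) ?coprimepZr ?dvdpZl //.
- congr (_ * _)%N; apply: eq_card => u; rewrite !inE dvdpZl //.
- by rewrite monicE lead_coefZ mulVf // lead_coef_eq0.
by rewrite size_scale.
Qed.
End Arithmetic.

(** * The action of polynomials through the Frobenius automorphism *)

Section FrobeniusModule.

Context {F : finFieldType} {L : fieldExtType F}.
Implicit Types (x y : L) (f g h p P Q : {poly F}) (d n : nat).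

Definition act p x : L := \sum_(i < size p) p`_i *: frob i x.

Lemma act_widen n p x : (size p <= n)%N ->
  act p x = \sum_(i < n) p`_i *: frob i x.
Proof.
move=> pn; rewrite /act (big_ord_widen n (fun i => p`_i *: frob i x)) //.
rewrite big_mkcond; apply: eq_bigr => i _.
by case: ltnP => // ?; rewrite nth_default ?scale0r.
Qed.

Fact act_is_linear p : linear (act p).
Proof.
move=> a x y; rewrite /act scaler_sumr -big_split; apply: eq_bigr => i _ /=.
by rewrite linearP scalerDr !scalerA mulrC.
Qed.
HB.instance Definition _ p :=
  GRing.isSemilinear.Build F L L _ (act p)
    (GRing.semilinear_linear (act_is_linear p)).

Lemma act0p x : act 0 x = 0.
Proof. by rewrite /act size_poly0 big_ord0. Qed.

Lemma actDp p q x : act (p + q) x = act p x + act q x.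
Proof.
pose n := maxn (size p) (size q).
rewrite !(@act_widen n) ?leq_maxl ?leq_maxr ?size_polyD // -big_split.
by apply: eq_bigr => i _ /=; rewrite coefD scalerDl.
Qed.

Lemma actZp a p x : act (a *: p) x = a *: act p x.
Proof.
rewrite (@act_widen (size p)) ?size_scale_leq // /act scaler_sumr.
by apply: eq_bigr => i _; rewrite coefZ scalerA.
Qed.

Lemma actBp p q x : act (p - q) x = act p x - act q x.
Proof. by rewrite actDp -scaleN1r actZp scaleN1r. Qed.

Lemma actXn n x : act 'X^n x = frob n x.
Proof.
rewrite /act size_polyXn big_ord_recr big1 /= ?coefXn ?eqxx ?scale1r ?add0r //.
by move=> i _; rewrite coefXn ltn_eqF ?scale0r.
Qed.

Lemma frobD m n x : frob (m + n) x = frob m (frob n x).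
Proof. by rewrite /frob -exprM -expnD addnC. Qed.

Lemma act1p x : act 1 x = x.
Proof. by rewrite -(expr0 'X) actXn /frob expr1. Qed.

Lemma act_sum (I : Type) (r : seq I) (p_ : I -> {poly F}) x :
  act (\sum_(i <- r) p_ i) x = \sum_(i <- r) act (p_ i) x.
Proof. exact: (big_morph (act^~ x) (fun p q => actDp p q x) (act0p x)). Qed.

Lemma act_frob p n x : act (p * 'X^n) x = act p (frob n x).
Proof.
rewrite -{1}[p]coefK poly_def mulr_suml act_sum; apply: eq_bigr => i _.
by rewrite -scalerAl -exprD actZp actXn frobD.
Qed.

Lemma actM p q x : act (p * q) x = act p (act q x).
Proof.
rewrite -{1}[q]coefK poly_def mulr_sumr act_sum [act q x]/act linear_sum.
by apply: eq_bigr => i _; rewrite -scalerAr actZp act_frob linearZ.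
Qed.

Lemma act_Xn_sub1 n x : (act ('X^n - 1) x == 0) = (x \in Fqn L n).
Proof. by rewrite actBp actXn act1p subr_eq0 mem_Fqn. Qed.

(** As a function of x, [act p x] is a polynomial with leading term of degree
    #|F| ^ (size p - 1) < #|L|, so it cannot vanish on all of L. *)
Lemma act_faithful p : p != 0 -> (size p <= \dim {:L})%N ->
  exists x, act p x != 0.
Proof.
move=> p0 pm; pose K := FinFieldExtType L.
have q1 : (1 < #|F|)%N := finNzRing_gt1 F.
have [/existsP[x xP]|/existsPn/= p_all] := boolP [exists x : K, act p (x : L) != 0].
  by exists x.
pose R : {poly L} := \sum_(i < size p) (p`_i)%:A *: 'X^(#|F| ^ i).
have sz0 : (0 < size p)%N by rewrite size_poly_gt0.
have R0 : R != 0.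
  apply: contraNneq p0 => /(congr1 (fun r : {poly L} => r`_(#|F| ^ (size p).-1))).
  rewrite coef0 coef_sum -(prednK sz0) big_ord_recr big1 /= => [|i _]; last first.
    by rewrite coefZ coefXn eqn_exp2l // gtn_eqF // mulr0.
  rewrite coefZ coefXn eqxx mulr1 add0r -lead_coefE => /eqP.
  by rewrite scaler_eq0 oner_eq0 orbF lead_coef_eq0.
have Rroot : all (root R) (enum K).
  apply/allP=> x _; move: (p_all x); rewrite negbK => /eqP px.
  rewrite /root horner_sum -[X in _ == X]px; apply/eqP.
  by apply: eq_bigr => i _; rewrite hornerZ hornerXn -scalerAl mul1r.
have := max_poly_roots R0 Rroot (enum_uniq K); rewrite ltnNge => /negP[].
have -> : size (enum K) = (#|F| ^ \dim {:L})%N.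
  rewrite -(card_vspace (fullv : {vspace finvect_type L})) -cardE.
  by apply: eq_card => x; rewrite memvf.
apply: leq_trans (size_sum _ _ _) _; apply/bigmax_leqP => i _.
apply: leq_trans (size_scale_leq _ _) _; rewrite size_polyXn ltn_exp2l //.
exact: leq_trans pm.
Qed.

(** * Annihilators and the existence of a generator *)

(** The annihilator of x is the ideal <P>; no choice is made between the
    associates of P. *)
Definition qorder x P := forall h, (act h x == 0) = (P %| h).

Lemma qorder_kill x P : qorder x P -> act P x = 0.
Proof. by move=> xP; apply/eqP; rewrite xP. Qed.

Lemma act_coprime_eq0 p q x : coprimep p q ->
  act p x = 0 -> act q x = 0 -> x = 0.
Proof.
case/Bezout_eq1_coprimepP => -[u v] /= uv1 px qx.
by rewrite -[x]act1p -uv1 actDp !actM px qx !linear0 addr0.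
Qed.

Lemma qorder_divisor P Q x : Q != 0 -> qorder x (P * Q) -> qorder (act Q x) P.
Proof. by move=> Q0 xPQ h; rewrite -actM xPQ dvdp_mul2r. Qed.

(** Multiplication by f is injective on F[x]/<P> if f is coprime to P;
    otherwise P / gcd(P, f) already annihilates [act f x]. *)
Lemma qorder_act P f x : P != 0 -> qorder x P ->
  qorder (act f x) P <-> coprimep f P.
Proof.
move=> P0 xP; split=> [fxP|fP h]; last first.
  by rewrite -actM xP Gauss_dvdpl // coprimep_sym.
rewrite coprimep_sym coprimep_def.
have gP := dvdp_gcdl P f; have gf := dvdp_gcdr P f.
have: P %| P %/ gcdp P f.
  rewrite -fxP -actM xP -{1}(divpK gP) dvdp_mul2l //.
  by apply: contraNneq P0 => PG0; rewrite -(divpK gP) PG0 mul0r.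
have D0 : P %/ gcdp P f != 0.
  by apply: contraNneq P0 => PG0; rewrite -(divpK gP) PG0 mul0r.
have g0 : gcdp P f != 0 by rewrite gcdp_eq0 negb_and P0.
move/(dvdp_leq D0); rewrite -{1}(divpK gP) size_mul //.
move: D0 g0; rewrite -!size_poly_gt0.
case: (size _) => // a _; case: (size _) => // b _.
by rewrite addnS /= -[X in (_ <= X)%N]addn0 leq_add2l leqn0.
Qed.

(** If h annihilates x + y, then h x = - (h y) is annihilated by P and by Q,
    hence is 0: the two annihilators are met separately. *)
Lemma qorderD x y P Q : coprimep P Q -> qorder x P -> qorder y Q ->
  qorder (x + y) (P * Q).
Proof.
move=> PQ xP yQ h; rewrite Gauss_dvdp //; apply/eqP/andP=> [hxy|[Ph Qh]].
  have hx0 : act h x = 0.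
    apply: (act_coprime_eq0 PQ).
      by rewrite -actM mulrC actM (qorder_kill xP) linear0.
    have -> : act h x = - act h y by apply/eqP; rewrite -addr_eq0 -hxy linearD.
    by rewrite linearN /= -actM mulrC actM (qorder_kill yQ) linear0 oppr0.
  split; first by rewrite -xP hx0.
  by rewrite -yQ; move: hxy; rewrite linearD /= hx0 add0r => ->.
rewrite linearD /=; move: Ph Qh.
by rewrite -xP -yQ => /eqP -> /eqP ->; rewrite addr0.
Qed.

Lemma act_Xdim_sub1 x : act ('X^(\dim {:L}) - 1) x = 0.
Proof.
apply/eqP; rewrite act_Xn_sub1; have -> : Fqn L (\dim {:L}) = fullv :> {vspace L}.
  by apply/eqP; rewrite eqEdim subvf dim_Fqn ?adim_gt0 ?leqnn.
exact: memvf.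
Qed.

(** Induction on the degree.  A reducible squarefree P splits into two coprime
    factors, to which [qorderD] applies; for an irreducible P, [act_faithful]
    gives v with (M / P) v nonzero, and this element works because an h that is
    not a multiple of P is coprime to P. *)
Lemma exists_qorder P : P %| 'X^(\dim {:L}) - 1 -> separable_poly P ->
  exists x, qorder x P.
Proof.
set M := 'X^_ - 1; have [n] := ubnP (size P); elim: n P => // n IHn P.
rewrite ltnS => szP PM sepP.
have m0 : (0 < \dim {:L})%N by rewrite adim_gt0.
have M0 : M != 0 by rewrite -size_poly_gt0 size_XnsubC.
have [P1|P1] := leqP (size P) 1.
  exists 0 => h; rewrite linear0 eqxx; symmetry.
  have : size P == 1 by rewrite eqn_leq P1 size_poly_gt0 (dvdpN0 PM).
  by rewrite size_poly_eq1 => /eqp_dvdl->; rewrite dvd1p.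
have [irrP|] := boolP (irreducibleb P).
  have /irreducibleP iP := irrP.
  have [|//|v Mv] := @act_faithful (M %/ P).
  - by apply: contraNneq M0 => D0; rewrite -(divpK PM) D0 mul0r.
  - rewrite size_divp ?(dvdpN0 PM) // size_XnsubC //.
    rewrite leq_subLR; case: (size P) P1 => [|[|s]] //= _.
    by rewrite addSn ltnS leq_addl.
  exists (act (M %/ P) v) => h; apply/idP/idP => [/eqP hv|/dvdpP[w ->]].
    apply: contraNT Mv; rewrite -irreducible_poly_coprime // => Ph.
    apply/eqP; apply: act_coprime_eq0 Ph _ hv; rewrite -actM mulrC divpK //.
    exact: act_Xdim_sub1.
  by rewrite actM -(actM P) mulrC divpK // act_Xdim_sub1 linear0.
rewrite /irreducibleb P1 /= => /forallPn[/= q]; rewrite negb_imply -ltnNge.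
rewrite -Pdiv.Idomain.dvdpE => /andP[/divpK qP q1].
have szq : (size q < size P)%N.
  by rewrite (leq_ltn_trans (size_npoly q)) // prednK // ltnW.
have szr : (size (P %/ q)%R < size P)%N.
  rewrite size_divp; last by rewrite -size_poly_gt0 ltnW.
  by rewrite ltn_subrL -subn1 subn_gt0 q1 ltnW.
move: sepP PM; rewrite -qP separable_mul => /and3P[sepr sepq rq] rqM.
have [x xr] := IHn _ (leq_trans szr szP) (dvdp_trans (dvdp_mulIl _ _) rqM) sepr.
have [y yq] := IHn _ (leq_trans szq szP) (dvdp_trans (dvdp_mulIr _ _) rqM) sepq.
by exists (x + y); exact: qorderD.
Qed.

Lemma separable_Xn_sub1_coprime n :
  coprime n #|F| -> separable_poly ('X^n - 1 : {poly F}).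
Proof.
move=> nF; have [p p_pr pF] := finPcharP F.
rewrite cyclotomic.separable_Xn_sub_1 // -(dvdn_pcharf pF).
have := finNzRing_gt1 F; move: nF; rewrite (card_pprimeChar pF).
case: (logn p _) => [|e]; first by rewrite expn0 ltnn.
by rewrite coprime_pexpr // coprime_sym prime_coprime.
Qed.

(** * Traces and normal elements *)

(** The quotient of X^n - 1 by X^d - 1 when d divides n, written as the geometric
    sum that matches the definition of the trace. *)
Definition trpoly n d : {poly F} := \sum_(i < n %/ d) 'X^(i * d).

Lemma Tr_act n d x : Tr n d x = act (trpoly n d) x.
Proof. by rewrite /trpoly act_sum; apply: eq_bigr => i _; rewrite actXn. Qed.

Lemma trpolyM n d : (d %| n)%N -> trpoly n d * ('X^d - 1) = 'X^n - 1.
Proof.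
move=> dn; rewrite mulrC -{2}(divnK dn) [in RHS]mulnC exprM [in RHS]subrX1.
by congr (_ * _); apply: eq_bigr => i _; rewrite -exprM mulnC.
Qed.

Lemma Xn_sub1_neq0 n : (0 < n)%N -> 'X^n - 1 != 0 :> {poly F}.
Proof. by move=> n0; rewrite -size_poly_gt0 size_XnsubC. Qed.

Lemma trpoly_trans n e d : (0 < d)%N -> (d %| e)%N -> (e %| n)%N ->
  trpoly e d * trpoly n e = trpoly n d.
Proof.
move=> d0 de en; apply: (mulIf (Xn_sub1_neq0 d0)).
by rewrite mulrAC !trpolyM ?(dvdn_trans de) // mulrC trpolyM.
Qed.

(** If gcd(a, b) + c b = e a, then X^gcd(a, b) - 1 is the difference of X^(e a) - 1
    and X^gcd(a, b) (X^(c b) - 1). *)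
Lemma gcdp_Xn_sub1 a b : (0 < a)%N ->
  gcdp ('X^a - 1) ('X^b - 1) %| ('X^(gcdn a b) - 1 : {poly F}).
Proof.
move=> a0; have [c _ /dvdnP[e eE]] := Bezoutl b a0.
have dvX n k : 'X^n - 1 %| ('X^(k * n) - 1 : {poly F}).
  by rewrite -(@trpolyM (k * n) n) ?dvdn_mull // dvdp_mulIr.
have -> : 'X^(gcdn a b) - 1
    = 'X^(e * a) - 1 - 'X^(gcdn a b) * ('X^(c * b) - 1) :> {poly F}.
  by rewrite -eE exprD; ring.
apply: dvdp_sub; first exact: dvdp_trans (dvdp_gcdl _ _) (dvX _ _).
by apply: dvdp_mull; exact: dvdp_trans (dvdp_gcdr _ _) (dvX _ _).
Qed.

Lemma conjugates_tuple n x :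
  [seq x ^+ (#|F| ^ i) | i <- iota 0 n] = [tuple frob i x | i < n].
Proof. by rewrite /= -val_enum_ord -map_comp. Qed.

(** Freeness of the conjugates of x says that no nonzero polynomial of degree
    less than n annihilates x; reducing modulo X^n - 1, which annihilates x
    when x lies in F_{q^n}, this determines the whole annihilator. *)
Lemma normal_eltE n x : (0 < n)%N -> (n %| \dim {:L})%N ->
  normal_elt n x <-> qorder x ('X^n - 1).
Proof.
move=> n0 nm; pose X := [tuple frob i x | i < n].
have X_nth (i : 'I_n) : X`_i = frob i x by rewrite -tnth_nth tnth_mktuple.
have act_X h : (size h <= n)%N -> act h x = \sum_(i < n) h`_i *: X`_i.
  by move=> /act_widen ->; apply: eq_bigr => i _; rewrite X_nth.
rewrite /normal_elt conjugates_tuple -/X basisEfree dim_Fqn //.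
rewrite size_tuple leqnn andbT; split.
  case/andP=> /freeP frX /span_subvP XFq h.
  have xFq : act ('X^n - 1) x = 0.
    apply/eqP; rewrite act_Xn_sub1; have := XFq _ (mem_tnth (Ordinal n0) X).
    by rewrite tnth_mktuple /frob expr1.
  have M0 := Xn_sub1_neq0 n0; set M := 'X^n - 1 in xFq M0 *.
  have szr : (size (h %% M)%R <= n)%N.
    by rewrite -ltnS -(size_XnsubC (1 : F) n0) ltn_modp.
  rewrite [in LHS](divp_eq h M) actDp actM xFq linear0 add0r act_X //.
  apply/eqP/modp_eq0P => [/frX r0|->].
    apply/polyP => i; rewrite coef0; case: (ltnP i n) => [lt_in|ge_in].
      exact: r0 (Ordinal lt_in).
    by rewrite nth_default // (leq_trans szr).
  by rewrite big1 // => i _; rewrite coef0 scale0r.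
move=> xM; have xFq : x \in Fqn L n by rewrite -act_Xn_sub1 xM.
apply/andP; split; last first.
  apply/span_subvP => _ /tnthP[i ->]; rewrite tnth_mktuple.
  exact: rpredX.
apply/freeP => k kX i.
pose h := \poly_(j < n) (if insub j is Some i0 then k i0 else 0).
have hE (j : 'I_n) : h`_j = k j by rewrite coef_poly ltn_ord valK.
have: 'X^n - 1 %| h.
  rewrite -xM act_X ?size_poly // -[X in _ == X]kX.
  by apply/eqP/eq_bigr => j _; rewrite hE.
have [h0 _|h0 /(dvdp_leq h0)] := eqVneq h 0; first by rewrite -hE h0 coef0.
by rewrite size_XnsubC // leqNgt ltnS size_poly.
Qed.

(** * Coordinates with respect to a generator *)

Section Generator.

Variable b : L.
Hypothesis ob : qorder b ('X^(\dim {:L}) - 1).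

Lemma generator_surj x : exists f, x = act f b.
Proof.
have m0 : (0 < \dim {:L})%N by rewrite adim_gt0.
have /normal_eltE := ob => /(_ m0 (dvdnn _))/andP[/eqP + _].
rewrite conjugates_tuple => spanE.
have : x \in Fqn L (\dim {:L}).
  by rewrite -act_Xn_sub1 act_Xdim_sub1.
rewrite -spanE => /coord_span ->.
exists (\sum_(i < \dim {:L})
          coord [tuple frob j b | j < \dim {:L}] i x *: 'X^i).
rewrite act_sum; apply: eq_bigr => i _.
by rewrite actZp actXn -tnth_nth tnth_mktuple.
Qed.

Lemma generator_trace n : (0 < n)%N -> (n %| \dim {:L})%N ->
  qorder (act (trpoly (\dim {:L}) n) b) ('X^n - 1).
Proof.
move=> n0 nm; apply: qorder_divisor; last by rewrite mulrC trpolyM.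
have := Xn_sub1_neq0 (adim_gt0 {:L}); apply: contraNneq => t0.
by rewrite -(trpolyM nm) t0 mul0r.
Qed.

Lemma Fqn_generator n x : (0 < n)%N -> (n %| \dim {:L})%N -> x \in Fqn L n ->
  exists f, x = act f (act (trpoly (\dim {:L}) n) b).
Proof.
move=> n0 nm; have [f ->] := generator_surj x.
rewrite -act_Xn_sub1 -actM ob -(trpolyM nm) mulrC dvdp_mul2l ?Xn_sub1_neq0 //.
by case/dvdpP=> h ->; exists h; rewrite actM.
Qed.

Lemma Tr_generator n f h : (0 < n)%N -> (n %| \dim {:L})%N ->
  (Tr (\dim {:L}) n (act f b) == act h (act (trpoly (\dim {:L}) n) b))
    = ('X^n - 1 %| f - h).
Proof.
move=> n0 nm; rewrite Tr_act -actM mulrC actM -subr_eq0 -actBp.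
exact: generator_trace.
Qed.

(** Traces are transitive on polynomials, (X^n - 1)/(X^e - 1) times
    (X^m - 1)/(X^n - 1) being (X^m - 1)/(X^e - 1), so taking the trace keeps the
    coordinate h. *)
Lemma Tr_generator_subfield n e h :
    (0 < e)%N -> (e %| n)%N -> (n %| \dim {:L})%N ->
  Tr n e (act h (act (trpoly (\dim {:L}) n) b))
    = act h (act (trpoly (\dim {:L}) e) b).
Proof.
move=> e0 en nm; rewrite Tr_act -(trpoly_trans e0 en nm) -!actM.
by congr act; ring.
Qed.

(** The residue class of f modulo X^m - 1 is a coordinate of [act f b], which
    turns counting in L into counting in F[x]/<X^m - 1>. *)
Lemma card_unit_combinations g h (S : {set finvect_type L}) :
    (forall f, ((act f b : finvect_type L) \in S)
       = coprimep f ('X^(\dim {:L}) - 1) && (g %| f - h)) ->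
  g %| 'X^(\dim {:L}) - 1 ->
  #|S| = #|unit_fiber ('X^(\dim {:L}) - 1) g h|.
Proof.
set M : {poly F} := 'X^_ - 1 => SE gM.
have Mm : M \is monic by rewrite monicXnsubC ?adim_gt0.
have M1 : (1 < size M)%N by rewrite size_XnsubC ?ltnS ?adim_gt0.
pose r (u : {poly %/ M}) : finvect_type L := act (val u) b.
have r_in f : r (in_qpoly _ f) = act f b.
  rewrite /r val_in_qpoly // [in RHS](divp_eq f M) actDp actM (qorder_kill ob).
  by rewrite linear0 add0r.
have r_inj : injective r.
  move=> u v /eqP; rewrite -subr_eq0 -actBp ob -eq_in_qpoly // !in_qpoly_val.
  by move/eqP.
rewrite -(card_imset _ r_inj); apply: eq_card => x.
have [f ->] := generator_surj x; rewrite -r_in mem_imset // r_in SE inE.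
by rewrite coprimep_in_qpoly // dvdp_in_qpoly.
Qed.

End Generator.

End FrobeniusModule.

(** * The number of normal elements with prescribed traces *)

Theorem theorem3p6 (F : finFieldType) (L : fieldExtType F) (m k : nat)
    (d : k.-tuple nat) (a : k.-tuple L)
    (hdim : \dim {:L} = m)
    (hcop : coprime m #|F|)
    (hpp : ~ exists p e : nat, [/\ prime p, (0 < e)%N & m = (p ^ e)%N])
    (hk : (1 < k < size (divisors m))%N)
    (hd : lambda m d)
    (ha : normal_admissible d a) :
  let g : {poly F} := \big[@lcmp F/1]_(i < k) ('X^(tnth d i) - 1) in
  #|[set alpha : finvect_type L |
      normal_elt m (alpha : L)
      & [forall i : 'I_k, Tr m (tnth d i) (alpha : L) == tnth a i]]|%:R
  = (Phi ('X^m - 1 : {poly F}))%:R / (Phi g)%:R :> rat.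
Proof.
move=> g; subst m; set m : nat := \dim _ in hcop hk hd *.
have m0 : (0 < m)%N by rewrite adim_gt0.
have [k1 _] := andP hk.
have [b ob] := exists_qorder (dvdpp _) (separable_Xn_sub1_coprime hcop).
have [[aF aTr] aN] := ha; have [dm _ _ _] := hd.
have {}dm i : (tnth d i %| m)%N by have := dm i; rewrite -dvdn_divisors.
have d0 i : (0 < tnth d i)%N by apply: dvdn_gt0 (dm i).
have [h_ aE] := fin_all_exists (fun i => Fqn_generator ob (d0 i) (dm i) (aF i)).
have hU i : coprimep (h_ i) ('X^(tnth d i) - 1).
  apply/(qorder_act _ (Xn_sub1_neq0 (d0 i)) (generator_trace ob (d0 i) (dm i))).
  by rewrite -aE; apply/normal_eltE.
have e0 i j : (0 < gcdn (tnth d i) (tnth d j))%N by rewrite gcdn_gt0 d0.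
have hTr i j : Tr (tnth d i) (gcdn (tnth d i) (tnth d j)) (tnth a i)
    = Tr (tnth d j) (gcdn (tnth d i) (tnth d j)) (tnth a j).
  case: (ltngtP i j) => [ij|ji|/ord_inj-> //]; first exact: aTr.
  by rewrite gcdnC aTr.
(* Admissibility makes the congruences f = h_ i compatible. *)
have hcompat i j : gcdp ('X^(tnth d i) - 1) ('X^(tnth d j) - 1) %| h_ i - h_ j.
  apply: dvdp_trans (gcdp_Xn_sub1 _ (d0 i)) _.
  have em : (gcdn (tnth d i) (tnth d j) %| m)%N.
    by rewrite (dvdn_trans (dvdn_gcdl _ _)).
  rewrite -(generator_trace ob (e0 i j) em) actBp subr_eq0.
  have := hTr i j; rewrite !aE !Tr_generator_subfield ?dvdn_gcdl ?dvdn_gcdr //.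
  by move/eqP.
have Xd0 (i : 'I_k) : 'X^(tnth d i) - 1 != 0 :> {poly F} by exact: Xn_sub1_neq0.
have [h hE] := crt_compatible (enum 'I_k) Xd0 hcompat.
have {}hE i : 'X^(tnth d i) - 1 %| h - h_ i by rewrite hE // mem_enum.
have hg : coprimep h g.
  apply: (big_ind (fun G => coprimep h G)); first exact: coprimep1.
    by move=> A B; exact: coprimep_lcmr.
  by move=> i _; exact: coprimep_congr (hE i) (hU i).
have gM : g %| 'X^m - 1.
  by apply/dvdp_biglcm => // i; rewrite -(trpolyM (dm i)) dvdp_mulIr.
have M0 : 'X^m - 1 != 0 :> {poly F} := Xn_sub1_neq0 m0.
have g1 : (1 < size g)%N.
  pose i0 : 'I_k := Ordinal (ltnW k1).
  have /dvdp_biglcm/(_ i0)/dvdp_leq := dvdpp g => // szg.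
  apply: leq_trans (szg _ _); rewrite ?size_XnsubC //.
    by rewrite ltnS.
  exact: dvdpN0 gM M0.
rewrite (card_unit_combinations (h := h) ob _ gM); last first.
  move=> f; rewrite inE; congr (_ && _).
    apply/idP/idP => [/(normal_eltE _ m0 (dvdnn _))|].
      by move/(qorder_act f M0 ob).
    by move/(qorder_act f M0 ob)/(normal_eltE _ m0 (dvdnn _)).
  have fE i : (Tr m (tnth d i) (act f b) == tnth a i)
      = ('X^(tnth d i) - 1 %| f - h).
    by rewrite aE Tr_generator // -[f in LHS](subrK h) -addrA dvdp_addl.
  apply/forallP/dvdp_biglcm => // fP i; first by rewrite -fE.
  by rewrite fE.
have Mm : 'X^m - 1 \is @monic F by rewrite monicXnsubC.
rewrite -(card_unit_fiber_Phi Mm g1 gM hg).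
by rewrite natrM mulfK // Num.Theory.pnatr_eq0 -lt0n Phi_gt0.
Qed.
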